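(* Fix $k\ge 3$. Assume that computing $\#1\mathrm{Fact}_{\mathrm{lab}}(B)$ is \#P-hard already on the class of $k$-regular bipartite multigraphs $B=(U,W,E)$ such that $|U|=|W|=p$ is prime and the associated directed multigraph $H_B$ is strongly connected. Then computing \[ G\longmapsto \#\mathrm{NSC}(G) \] is \#P-hard on the class of strongly connected Eulerian $k$-out graphs with a prime number of vertices. Consequently, under this assumption, the problem is \#P-complete on that class.
   Context: A graph is a finite directed multigraph $G=(V,E,s,t)$ with source and target maps $s,t:E\to V$ (loops and parallel edges allowed). It is $k$-out if every vertex has exactly $k$ outgoing edges; a $k$-out graph is Eulerian if every vertex also has exactly $k$ incoming edges. A coloring of a $k$-out graph $G$ is a map $\chi:E\to[k]=\{1,\dots,k\}$ whose restriction to the set of outgoing edges of each vertex is a bijection onto $[k]$. It defines the deterministic complete automaton $\chi(G)=(V,[k],\delta_\chi)$, where $\delta_\chi(v,a)=t(e)$ for the unique edge $e$ with $s(e)=v$, $\chi(e)=a$. The automaton is synchronizing if there is a word $w\in[k]^*$ with $|V\cdot w|=1$. $\#\mathrm{NSC}(G)$ is the number of colorings $\chi$ of $G$ for which $\chi(G)$ is not synchronizing. For a $k$-regular bipartite (undirected) multigraph $B=(U,W,E)$ with $|U|=|W|$, a labeled $1$-factorization is an ordered $k$-tuple $(M_1,\dots,M_k)$ of pairwise edge-disjoint perfect matchings whose union is $E$; $\#1\mathrm{Fact}_{\mathrm{lab}}(B)$ is the number of labeled $1$-factorizations of $B$. Writing $U=\{u_1,\dots,u_m\}$, $W=\{w_1,\dots,w_m\}$,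 the directed multigraph $H_B$ has vertex set $\{v_1,\dots,v_m\}$ and, for every edge of $B$ with endpoints $u_i$ and $w_j$ (counted with multiplicity), one directed edge from $v_i$ to $v_j$. *)

(* Defs.v *)
From mathcomp Require Import all_boot all_order all_algebra.
From mathcomp Require Import boolp.

Set Implicit Arguments.
Unset Strict Implicit.
Unset Printing Implicit Defensive.

(** * Directed multigraphs, colorings and synchronization *)

Record digraph := Digraph {
  vert : finType;
  edge : finType;
  src : edge -> vert;
  tgt : edge -> vert
}.

Definition out_edges (G : digraph) (v : vert G) : {set edge G} :=
  [set e | src e == v].
Definition in_edges (G : digraph) (v : vert G) : {set edge G} :=
  [set e | tgt e == v].

Definition k_out (k : nat) (G : digraph) : Prop :=
  forall v : vert G, #|out_edges v| = k.

Definition eulerian (k : nat) (G : digraph) : Prop :=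
  k_out k G /\ forall v : vert G, #|in_edges v| = k.

Definition arc (G : digraph) : rel (vert G) :=
  fun u v => [exists e, (src e == u) && (tgt e == v)].

Definition strongly_connected (G : digraph) : Prop :=
  forall u v : vert G, connect (@arc G) u v.

(** The color set [k] is ['I_k]. *)
Definition coloring (k : nat) (G : digraph) (chi : {ffun edge G -> 'I_k}) : bool :=
  [forall v : vert G, dinjectiveb chi (mem (out_edges v))
                      && (chi @: out_edges v == [set: 'I_k])].

(** When [chi] is a coloring the edge picked exists and is unique; the default
    value [v] only makes the function total. *)
Definition delta (k : nat) (G : digraph) (chi : {ffun edge G -> 'I_k})
    (v : vert G) (a : 'I_k) : vert G :=
  if [pick e | (src e == v) && (chi e == a)] is Some e then tgt e else v.

Definition synchronizing (A : Type) (V : finType) (d : V -> A -> V) : Prop :=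
  exists w : seq A, #|[set foldl d v w | v in V]| = 1.

Definition num_NSC (k : nat) (G : digraph) : nat :=
  #|[set chi : {ffun edge G -> 'I_k} |
      coloring chi && ~~ `[< synchronizing (delta chi) >]]|.

(** * Bipartite multigraphs with sides of equal size, and 1-factorizations *)

Record bigraph := Bigraph {
  bU : finType;
  bW : finType;
  bE : finType;
  bu : bE -> bU;
  bw : bE -> bW;
  bcard : #|bU| = #|bW|
}.

Definition bregular (k : nat) (B : bigraph) : Prop :=
  (forall u : bU B, #|[set e | bu e == u]| = k) /\
  (forall w : bW B, #|[set e | bw e == w]| = k).

Definition perfect_matching (B : bigraph) (M : {set bE B}) : bool :=
  [forall u : bU B, #|[set e in M | bu e == u]| == 1] &&
  [forall w : bW B, #|[set e in M | bw e == w]| == 1].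

Definition lab_1fact (k : nat) (B : bigraph)
    (M : {ffun 'I_k -> {set bE B}}) : bool :=
  [&& [forall i, perfect_matching (M i)],
      [forall i, forall j, (i != j) ==> [disjoint M i & M j]]
    & \bigcup_i M i == [set: bE B]].

Definition num_1Fact_lab (k : nat) (B : bigraph) : nat :=
  #|[set M : {ffun 'I_k -> {set bE B}} | lab_1fact M]|.

(** The numberings u_1, ..., u_m and w_1, ..., w_m of the two sides are the
    enumerations of the finite types [bU B] and [bW B]. *)
Definition H_ (B : bigraph) : digraph :=
  @Digraph 'I_#|bU B| (bE B)
    (fun e => enum_rank (bu e))
    (fun e => cast_ord (esym (bcard B)) (enum_rank (bw e))).

(** * Encoding of instances as binary words *)

Definition word := seq bool.

Definition unary (n : nat) : word := rcons (nseq n true) false.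

(** Number of vertices (per side), followed by the list of edges, each one given
    by the two indices of its endpoints.  Unary numbers make the length
    polynomial in the numbers of vertices and edges. *)
Definition edge_list_code (n : nat) (s : seq (nat * nat)) : word :=
  unary n ++ flatten [seq unary e.1 ++ unary e.2 | e <- s].

Definition digraph_code (G : digraph) : word :=
  edge_list_code #|vert G|
    [seq (enum_rank (src e) : nat, enum_rank (tgt e) : nat) | e <- enum (edge G)].

Definition bigraph_code (B : bigraph) : word :=
  edge_list_code #|bU B|
    [seq (enum_rank (bu e) : nat, enum_rank (bw e) : nat) | e <- enum (bE B)].

Fixpoint bits_rec (fuel n : nat) : word :=
  if fuel is f.+1 then
    if n == 0 then [::] else odd n :: bits_rec f n./2
  else [::].

(** Binary representation, least significant bit first, without trailing zeros. *)
Definition bits (n : nat) : word := bits_rec n n.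

(** * Deterministic multitape Turing machines *)

Inductive move := MoveLeft | Stay | MoveRight.

(** Tape cells contain [None] (blank), an input symbol [Some (inl b)], or one of
    finitely many auxiliary symbols [Some (inr a)]. *)
Definition cell (A : finType) : finType := option (bool + A).

(** The tapes are indexed by ['I_(extra_tapes M).+2].  [verdict q = Some b] says
    that [q] is a halting state, accepting iff [b]. *)
Record machine := Machine {
  state : finType;
  aux : finType;
  extra_tapes : nat;
  start : state;
  verdict : state -> option bool;
  trans : state -> {ffun 'I_extra_tapes.+2 -> cell aux} ->
          state * ('I_extra_tapes.+2 -> cell aux * move)
}.

(** A two-way infinite tape is a pair [(l, r)]: [r] starts with the scanned cell
    and goes to the right, [l] lists the cells to its left, nearest first; all
    the cells beyond the two lists are blank. *)
Definition tape (A : finType) := (seq (cell A) * seq (cell A))%type.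

Definition tread A (t : tape A) : cell A := head None t.2.

Definition twrite A (t : tape A) (c : cell A) : tape A := (t.1, c :: behead t.2).

Definition tmove A (t : tape A) (m : move) : tape A :=
  match m with
  | MoveLeft => (behead t.1, head None t.1 :: t.2)
  | Stay => t
  | MoveRight => (head None t.2 :: t.1, behead t.2)
  end.

Definition tape_of_word A (w : word) : tape A :=
  ([::], [seq Some (inl b) | b <- w]).

Fixpoint bit_prefix A (s : seq (cell A)) : word :=
  if s is Some (inl b) :: s' then b :: bit_prefix s' else [::].

(** The word written from the scanned cell up to the first non-bit. *)
Definition word_of_tape A (t : tape A) : word := bit_prefix t.2.

Definition config (M : machine) :=
  (state M * ('I_(extra_tapes M).+2 -> tape (aux M)))%type.

Definition tape0 (n : nat) : 'I_n.+2 := ord0.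
Definition tape1 (n : nat) : 'I_n.+2 := lift ord0 ord0.

Definition init_config (M : machine) (x y : word) : config M :=
  (start M, fun i => if i == tape0 _ then tape_of_word _ x
                     else if i == tape1 _ then tape_of_word _ y
                     else tape_of_word _ [::]).

Definition halted (M : machine) (c : config M) : bool := isSome (verdict c.1).

Definition accepted (M : machine) (c : config M) : bool :=
  verdict c.1 == Some true.

Definition step (M : machine) (c : config M) : config M :=
  if halted c then c else
  let a := trans c.1 [ffun i => tread (c.2 i)] in
  (a.1, fun i => tmove (twrite (c.2 i) (a.2 i).1) (a.2 i).2).

(** Halted configurations are fixed by [step], so [run] at time [T] shows the
    final configuration as soon as the machine halts within [T] steps. *)
Definition run (M : machine) (x y : word) (T : nat) : config M :=
  iter T (@step M) (init_config M x y).

(** Oracle machines: in a state [q] with [resume q = Some q'], the word on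
    [tape1] is replaced in one step by the binary representation of the oracle's
    answer to it, and the machine goes to the state [q']. *)
Record omachine := OMachine {
  base :> machine;
  resume : state base -> option (state base)
}.

Definition ostep (M : omachine) (O : word -> nat) (c : config M) : config M :=
  if halted c then c else
  if resume c.1 is Some q' then
    (q', fun i => if i == tape1 _
                  then tape_of_word _ (bits (O (word_of_tape (c.2 i))))
                  else c.2 i)
  else step c.

Definition orun (M : omachine) (O : word -> nat) (x : word) (T : nat) : config M :=
  iter T (@ostep M O) (init_config M x [::]).

(** * #P and #P-hardness *)

(** [q.[size x]] is the length of the witnesses, [p.[size x]] the running time;
    the verifier gets the input and the witness on its first two tapes. *)
Definition sharpP (f : word -> nat) : Prop :=
  exists (M : machine) (p q : {poly nat}), forall x : word,
    (forall y : (q.[size x]%R).-tuple bool, halted (run M x y p.[size x]%R)) /\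
    f x = #|[set y : (q.[size x]%R).-tuple bool | accepted (run M x y p.[size x]%R)]|.

(** Counting problems restricted to a class of instances. *)
Record counting_problem := CountingProblem {
  instance : Type;
  in_class : instance -> Prop;
  encode : instance -> word;
  value : instance -> nat
}.

Definition solves (O : word -> nat) (P : counting_problem) : Prop :=
  forall I : instance P, in_class I -> O (encode I) = value I.

(** Polynomial-time Turing reductions: the machine may rely only on the oracle's
    answers to instances in the class, since it must be correct for every oracle
    solving the problem on the class, whatever the other answers are. *)
Definition sharpP_hard (P : counting_problem) : Prop :=
  forall f : word -> nat, sharpP f ->
  exists (M : omachine) (p : {poly nat}),
    forall O : word -> nat, solves O P ->
    forall x : word,
      let c := orun M O x p.[size x]%R in
      halted c /\ word_of_tape (c.2 (tape0 _)) = bits (f x).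

Definition in_sharpP (P : counting_problem) : Prop :=
  exists f : word -> nat, sharpP f /\ solves f P.

Definition sharpP_complete (P : counting_problem) : Prop :=
  in_sharpP P /\ sharpP_hard P.

(** * The two counting problems *)

Definition Fact_problem (k : nat) : counting_problem :=
  @CountingProblem bigraph
    (fun B => [/\ bregular k B, prime #|bU B| & strongly_connected (H_ B)])
    bigraph_code (num_1Fact_lab k).

Definition NSC_problem (k : nat) : counting_problem :=
  @CountingProblem digraph
    (fun G => [/\ strongly_connected G, eulerian k G & prime #|vert G|])
    digraph_code (num_NSC k).

(* Main.v *)
(** By Friedman's argument, in a strongly connected Eulerian automaton the
    nonempty fibers of a word of minimal rank all have the same cardinality; when
    the number of vertices is prime, the automaton is therefore either
    synchronizing or made of permutations.  So the non-synchronizing colorings are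
    those that are injective on the edges into each vertex, i.e. the labeled
    1-factorizations of the bipartite double cover.  Since the encodings of [B]
    and of [H_ B] are the same word, an oracle for the colorings is an oracle for
    the factorizations, and no machine has to be transformed.

    For the membership in #P, a coloring is certified by the unary colors of the
    edges followed by zeros, and a three-tape machine checks in linear time that
    no two edges with a common source or a common target have the same color. *)
Require Import Defs.
From HB Require Import structures.
From mathcomp Require Import all_boot all_algebra.
From mathcomp Require Import boolp zify.

Set Implicit Arguments.
Unset Strict Implicit.
Unset Printing Implicit Defensive.

(** * Eulerian automata with a prime number of states *)

Section Automata.

Variables (A V : finType) (d : V -> A -> V).

Let fiber (w : seq A) (v : V) := [set x | foldl d x w == v].
Let rank (w : seq A) := #|[set foldl d x w | x in V]|.

Hypothesis indegree : forall v, \sum_a #|[set u | d u a == v]| = #|A|.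
Hypothesis transitive : forall u v, exists w, foldl d u w = v.

Lemma sum_card_preim (S : {set V}) :
  \sum_a #|[set u | d u a \in S]| = #|A| * #|S|.
Proof.
have E a : #|[set u | d u a \in S]| = \sum_(v in S) #|[set u | d u a == v]|.
  rewrite -sum1_card (partition_big (d^~ a) (mem S)) /=; last first.
    by move=> u; rewrite inE.
  apply: eq_bigr => v vS; rewrite -sum1_card; apply: eq_bigl => u.
  by rewrite !inE; case: eqP => [->|]; rewrite ?vS ?andbF.
rewrite (eq_bigr _ (fun a _ => E a)) exchange_big /=.
by rewrite (eq_bigr _ (fun v _ => indegree v)) sum_nat_const mulnC.
Qed.

(* Averaging: the preimages of a set under the letters have its cardinality on
   average, so none of them can be smaller than a fiber of maximal size. *)
Lemma card_fiber_cat (m : nat) (w : seq A) (v : V) :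
  (forall w' v', #|fiber w' v'| <= m) -> #|fiber w v| = m ->
  forall g, #|fiber (g ++ w) v| = m.
Proof.
move=> le_m wm; elim=> [//|a g IH].
have sub b : [set u | d u b \in fiber (g ++ w) v] = fiber (b :: g ++ w) v.
  by apply/setP=> u; rewrite !inE.
have := sum_card_preim (fiber (g ++ w) v).
rewrite IH -sum_nat_const; under eq_bigr => b _ do rewrite sub.
(* Every summand is at most [m] and the sum is [#|A| * m]: this is the equality case of the termwise
   bound. *)
have [_ eq_sum] := leqif_sum (fun b (_ : xpredT b) => leqif_eq (le_m (b :: g ++ w) v)).
by move/eqP; rewrite eq_sum => /forallP/(_ a)/eqP.
Qed.

Lemma max_fiber : 0 < #|V| ->
  exists m w v, #|fiber w v| = m /\ forall w' v', #|fiber w' v'| <= m.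
Proof.
case/card_gt0P=> v0 _.
pose P m := `[< exists w v, #|fiber w v| = m >].
have exP : exists m, P m by exists #|fiber [::] v0|; apply/asboolP; exists [::], v0.
have leP m : P m -> m <= #|V| by move=> /asboolP[w [v <-]]; apply: max_card.
case: (ex_maxnP exP leP) => m /asboolP[w [v wvm]] max.
by exists m, w, v; split=> // w' v'; apply/max/asboolP; exists w', v'.
Qed.

Lemma min_rank : exists w, forall w', rank w <= rank w'.
Proof.
pose P m := `[< exists w, rank w = m >].
have exP : exists m, P m by exists (rank [::]); apply/asboolP; exists [::].
case: (ex_minnP exP) => m /asboolP[w wm] min; exists w => w'; rewrite wm.
by apply/min/asboolP; exists w'.
Qed.

Lemma image_cat (z t : seq A) : [set foldl d x (z ++ t) | x in V] =
  [set foldl d v t | v in [set foldl d x z | x in V]].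
Proof. by rewrite -imset_comp; apply: eq_imset => x /=; rewrite foldl_cat. Qed.

(** If appending [t] does not lower the rank, then [t] is injective on the image of [z]. *)
Lemma rank_cat_inj (z t : seq A) : rank z <= rank (z ++ t) ->
  forall x y, foldl d x (z ++ t) = foldl d y (z ++ t) -> foldl d x z = foldl d y z.
Proof.
rewrite /rank image_cat => le_zt.
have /imset_injP inj : #|[set foldl d v t | v in [set foldl d x z | x in V]]|
    == #|[set foldl d x z | x in V]|.
  by rewrite eqn_leq leq_imset_card.
by move=> x y; rewrite !foldl_cat; apply: inj; apply: imset_f.
Qed.

Lemma rank_catl (z t : seq A) : rank (z ++ t) <= rank z.
Proof. by rewrite /rank image_cat leq_imset_card. Qed.

(* Friedman's argument: for a word of minimal rank, all the nonempty fibers have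
   the maximal size, because a fiber over [v'] is the preimage of a maximal fiber
   [S] under a word carrying [v'] into [S]. *)
Lemma min_rank_dvd : 0 < #|V| ->
  exists z m, (forall w, rank z <= rank w) /\ rank z * m = #|V|.
Proof.
move=> V_gt0; have [m [w [v [wm le_m]]]] := max_fiber V_gt0.
have [u min_u] := min_rank.
(* The prefix [u] brings the rank to its minimum and, by [card_fiber_cat], leaves the fiber over [v]
   of maximal size. *)
pose z := u ++ w; have min_z w' : rank z <= rank w'.
  exact: leq_trans (rank_catl _ _) (min_u w').
have zm : #|fiber z v| = m by apply: card_fiber_cat.
clearbody z; exists z, m; split=> //.
have m_gt0 : 0 < m.
  by case/card_gt0P: V_gt0 => x _; apply: leq_trans (le_m [::] x);
     apply/card_gt0P; exists x; rewrite inE /=.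
have fiber_m v' : v' \in [set foldl d x z | x in V] -> #|fiber z v'| = m.
  case/imsetP=> x0 _ ->.
  have /card_gt0P[s] : 0 < #|fiber z v| by rewrite zm.
  rewrite inE => /eqP sv; have [t ts] := transitive (foldl d x0 z) s.
  (* The fiber of [(z ++ t) ++ z] over [v] has size [m]; it is the fiber of [z] through [x0],
     because minimality of the rank makes [t ++ z] injective on the image of [z]. *)
  rewrite -(card_fiber_cat le_m zm (z ++ t)); apply: eq_card => x; rewrite !inE.
  have e0 : foldl d x0 ((z ++ t) ++ z) = v by rewrite !foldl_cat ts.
  apply/eqP/eqP=> [xx0|xv]; first by rewrite -e0 !foldl_cat xx0.
  apply: (@rank_cat_inj z (t ++ z)) => //.
  by rewrite catA xv e0.
rewrite -sum_nat_const -(eq_bigr _ fiber_m) -[RHS]sum1_card.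
rewrite [RHS](partition_big (foldl d ^~ z) (mem [set foldl d x z | x in V])) /=.
  by apply: eq_bigr => y _; rewrite -sum1_card; apply: eq_bigl => x; rewrite inE.
by move=> x _; apply: imset_f.
Qed.

Lemma synchronizing_or_injective : prime #|V| ->
  synchronizing d \/ forall a, injective (d^~ a).
Proof.
move=> pV; have [z [m [min_z zm]]] := min_rank_dvd (prime_gt0 pV).
have [_ /(_ (rank z))] := primeP pV.
rewrite -{1}zm dvdn_mulr // => /(_ isT)/orP[/eqP z1|/eqP zV].
  by left; exists z.
(* Here the minimal rank is [#|V|], so even a one-letter word has full rank. *)
right=> a x y xya; have /imset_injP inj : #|[set foldl d x [:: a] | x in V]| == #|V|.
  by rewrite eqn_leq leq_imset_card -zV min_z.
by apply: inj.
Qed.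

End Automata.

Lemma permutations_not_synchronizing (A : Type) (V : finType) (d : V -> A -> V) :
  1 < #|V| -> (forall a, injective (d^~ a)) -> ~ synchronizing d.
Proof.
move=> V_gt1 inj [w]; rewrite card_imset => [V1|]; first by rewrite V1 in V_gt1.
by elim: w => [|a w IH] x y //= /IH/inj.
Qed.

(** * Colorings and 1-factorizations *)

(** Both counts are reduced to these maps, the proper edge colorings of the bipartite double cover
    of [G]. *)
Definition proper_coloring (k : nat) (G : digraph) (chi : {ffun edge G -> 'I_k}) : bool :=
  injectiveb (fun e => (chi e, src e)) && injectiveb (fun e => (chi e, tgt e)).

(** An injection of the [k] edges leaving a vertex into the [k] colors is a bijection by
    counting. *)
Lemma coloringE (k : nat) (G : digraph) (chi : {ffun edge G -> 'I_k}) :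
  k_out k G -> coloring chi = injectiveb (fun e => (chi e, src e)).
Proof.
move=> Gk; apply/forallP/injectiveP => [col e e' [ee' se]|inj v].
  have /andP[/dinjectiveP inj _] := col (src e).
  by apply: inj => //=; rewrite inE ?se.
have injv : {in out_edges v &, injective chi}.
  by move=> e e'; rewrite !inE => /eqP se /eqP se' ee'; apply: inj; rewrite ee' se se'.
apply/andP; split; first exact/dinjectiveP.
by rewrite eqEcard subsetT cardsT card_ord card_in_imset //= Gk leqnn.
Qed.

(** * The automaton of a coloring *)

Section Delta.

Variables (k : nat) (G : digraph) (chi : {ffun edge G -> 'I_k}).
Hypotheses (G_eulerian : eulerian k G) (chi_col : coloring chi).

Let chi_inj : injective (fun e => (chi e, src e)).
Proof. by apply/injectiveP; rewrite -coloringE //; case: G_eulerian. Qed.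

Lemma delta_edge (e : edge G) : delta chi (src e) (chi e) = tgt e.
Proof.
rewrite /delta; case: pickP => [e' /andP[/eqP s /eqP c]|/(_ e)]; last by rewrite !eqxx.
by congr tgt; apply: chi_inj; rewrite s c.
Qed.

Lemma coloring_edge (v : vert G) (a : 'I_k) : exists2 e, src e = v & chi e = a.
Proof.
have /andP[_ /eqP/setP/(_ a)] := forallP chi_col v.
by rewrite inE => /imsetP[e]; rewrite inE => /eqP; exists e.
Qed.

(** The edges into [v] are split by color; the source map identifies those of color [a] with the
    states that [a] sends to [v]. *)
Lemma delta_indegree (v : vert G) : \sum_a #|[set u | delta chi u a == v]| = #|'I_k|.
Proof.
rewrite card_ord; transitivity #|in_edges v|; last by case: G_eulerian.
rewrite -[RHS]sum1_card [RHS](partition_big chi xpredT) //=.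
apply: eq_bigr => a _; rewrite sum1_card.
have inj : {in [pred e | (e \in in_edges v) && (chi e == a)] &, injective (@src G)}.
  move=> e e' /andP[_ /eqP ea] /andP[_ /eqP e'a] see'.
  by apply: chi_inj; rewrite ea e'a see'.
rewrite -(card_in_imset inj); apply: eq_card => u.
rewrite inE; apply/eqP/imsetP => [uv|[e]].
  have [e se ce] := coloring_edge u a.
  by exists e => //; rewrite !inE -delta_edge se ce uv !eqxx.
by rewrite !inE => /andP[/eqP<- /eqP<-] ->; rewrite delta_edge.
Qed.

Lemma delta_transitive : strongly_connected G ->
  forall u v, exists w, foldl (delta chi) u w = v.
Proof.
move=> sc u v; have /connectP[p pp ->] := sc u v.
elim: p u pp {sc} => [|x p IH] u /=; first by exists [::].
case/andP=> /existsP[e /andP[/eqP se /eqP te]] /IH[w <-].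
by exists (chi e :: w); rewrite /= -se delta_edge te.
Qed.

Lemma delta_injectiveP :
  (forall a, injective (delta chi ^~ a)) <-> injective (fun e => (chi e, tgt e)).
Proof.
split=> [inj e e' [cee' tee']|inj a u v].
  by apply: chi_inj; congr (_, _) => //; apply: (inj (chi e)); rewrite {2}cee' !delta_edge.
have [e <- ea] := coloring_edge u a; have [e' <- e'a] := coloring_edge v a.
by rewrite -{1}ea -{1}e'a !delta_edge => tee'; rewrite (inj e e') // ea e'a tee'.
Qed.

End Delta.

Lemma num_NSCE (k : nat) (G : digraph) :
    strongly_connected G -> eulerian k G -> prime #|vert G| ->
  num_NSC k G = #|[set chi : {ffun edge G -> 'I_k} | proper_coloring chi]|.
Proof.
move=> sc Gk pG; apply: eq_card => chi; rewrite !inE /proper_coloring -coloringE; last by case: Gk.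
apply: andb_id2l => col; apply/idP/injectiveP => [/asboolPn nsync|inj].
  apply/(delta_injectiveP Gk col).
  by case: (synchronizing_or_injective (delta_indegree Gk col)
              (delta_transitive Gk col sc) pG).
apply/asboolPn; apply: permutations_not_synchronizing; first exact: prime_gt1.
exact/(delta_injectiveP Gk col).
Qed.

(** * The digraph of a bipartite multigraph and its 1-factorizations *)

Lemma H_eulerian (k : nat) (B : bigraph) : bregular k B -> eulerian k (H_ B).
Proof.
case=> regU regW; split=> v.
  rewrite -(regU (enum_val v)); apply: eq_card => e; rewrite !inE /=.
  by apply/eqP/eqP=> [<-|->]; rewrite ?enum_rankK ?enum_valK.
rewrite -(regW (enum_val (cast_ord (bcard B) v))); apply: eq_card => e; rewrite !inE /=.
apply/eqP/eqP=> [<-|->]; first by rewrite cast_ordKV enum_rankK.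
by rewrite enum_valK cast_ordK.
Qed.

Lemma digraph_code_H (B : bigraph) : digraph_code (H_ B) = bigraph_code B.
Proof.
rewrite /digraph_code /bigraph_code /=; congr edge_list_code; first exact: card_ord.
by apply: eq_map => e /=; rewrite !enum_rank_ord.
Qed.

Lemma H_proper_coloring (k : nat) (B : bigraph) (chi : {ffun bE B -> 'I_k}) :
  @proper_coloring k (H_ B) chi =
  injectiveb (fun e => (chi e, bu e)) && injectiveb (fun e => (chi e, bw e)).
Proof.
congr andb; apply/injectiveP/injectiveP => inj e e' [c h]; apply: inj; rewrite c.
- by rewrite /= h.
- by congr (_, _); apply: enum_rank_inj.
- by rewrite /= h.
- by congr (_, _); apply/enum_rank_inj/ord_inj.
Qed.

Section Factorizations.

Variables (k : nat) (B : bigraph).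
Hypothesis B_regular : bregular k B.

Let classes (chi : {ffun bE B -> 'I_k}) : {ffun 'I_k -> {set bE B}} :=
  [ffun i => [set e | chi e == i]].

Let classes_inj : injective classes.
Proof.
move=> chi chi' /ffunP E; apply/ffunP=> e.
by have := E (chi e); rewrite !ffunE => /setP/(_ e); rewrite !inE eqxx => /esym/eqP.
Qed.

(** Both sides say that the [k] edges at each vertex use every color exactly once; [end_] stands for
    either endpoint map of [B]. *)
Lemma card_class (V : finType) (end_ : bE B -> V) (chi : {ffun bE B -> 'I_k}) :
    (forall v, #|[set e | end_ e == v]| = k) ->
  injectiveb (fun e => (chi e, end_ e)) =
  [forall i, forall v, #|[set e in classes chi i | end_ e == v]| == 1].
Proof.
move=> reg; apply/injectiveP/forallP => [inj i|all1 e e' [cc ee]]; last first.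
  have /forallP/(_ (end_ e))/cards1P[e0 E] := all1 (chi e).
  have : e \in [set e0] by rewrite -E !inE ffunE inE !eqxx.
  have : e' \in [set e0] by rewrite -E !inE ffunE inE cc ee !eqxx.
  by rewrite !inE => /eqP-> /eqP.
apply/forallP=> v.
have injv : {in [set e | end_ e == v] &, injective chi}.
  by move=> e e'; rewrite !inE => /eqP ev /eqP e'v cc; apply: inj; rewrite cc ev e'v.
have /setP/(_ i) : chi @: [set e | end_ e == v] = [set: 'I_k].
  by apply/eqP; rewrite eqEcard subsetT cardsT card_ord card_in_imset // reg leqnn.
rewrite !inE => /imsetP[e]; rewrite inE => /eqP ev ie; apply/cards1P; exists e.
apply/setP=> e'; rewrite !inE ffunE inE; apply/andP/eqP => [[/eqP ce /eqP ee]|->].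
  by apply: inj; rewrite ce ee ie ev.
by rewrite ie ev !eqxx.
Qed.

Lemma lab_1fact_classes (chi : {ffun bE B -> 'I_k}) :
  lab_1fact (classes chi) = @proper_coloring k (H_ B) chi.
Proof.
have [regU regW] := B_regular; rewrite H_proper_coloring !card_class // /lab_1fact.
set disj := [forall i, forall j, _]; set cov := _ == [set: _].
have -> : disj.
  apply/forallP=> i; apply/forallP=> j; apply/implyP=> ij.
  rewrite -setI_eq0; apply/eqP/setP=> e; rewrite !inE !ffunE !inE.
  by apply/negP=> /andP[/eqP-> /eqP ij']; rewrite ij' eqxx in ij.
have -> : cov.
  apply/eqP/setP=> e; rewrite inE; apply/bigcupP; exists (chi e) => //.
  by rewrite ffunE inE.
rewrite !andbT; apply/forallP/andP => [pm|[/forallP pU /forallP pW] i].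
  by split; apply/forallP=> i; case/andP: (pm i).
by apply/andP; split; [apply: pU | apply: pW].
Qed.

Lemma lab_1fact_coloring (M : {ffun 'I_k -> {set bE B}}) :
  lab_1fact M -> exists chi, M = classes chi.
Proof.
case/and3P=> _ /forallP disj /eqP cov.
(* The union being everything supplies a color for each edge; disjointness makes it unique. *)
have ex e : {i | e \in M i}.
  by apply: sigW; have := in_setT e; rewrite -cov => /bigcupP[i _ eM]; exists i.
exists [ffun e => sval (ex e)]; apply/ffunP=> i; apply/setP=> e.
rewrite !ffunE inE ffunE; case: (ex e) => j /= ej; apply/idP/eqP => [ei|<- //].
apply/eqP; apply: contraLR ei => ji; have /forallP/(_ i)/implyP/(_ ji) := disj j.
by move/disjointFr/(_ ej) => ->.
Qed.

Lemma num_1Fact_labE :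
  num_1Fact_lab k B = #|[set chi : {ffun edge (H_ B) -> 'I_k} | proper_coloring chi]|.
Proof.
rewrite -(card_imset _ classes_inj); apply: eq_card => M; rewrite inE.
apply/idP/imsetP => [MM|[chi]]; last by rewrite inE -lab_1fact_classes => ? ->.
have [chi Mchi] := lab_1fact_coloring MM.
by exists chi => //; rewrite inE -lab_1fact_classes -Mchi.
Qed.

End Factorizations.

Lemma sharpP_hard_NSC (k : nat) :
  sharpP_hard (Fact_problem k) -> sharpP_hard (NSC_problem k).
Proof.
move=> hard f /hard[M [p Mp]]; exists M, p => O O_NSC; apply: Mp => B [regB pB scB].
have EB := H_eulerian regB.
have pH : prime #|vert (H_ B)| by rewrite card_ord.
rewrite /= -digraph_code_H num_1Fact_labE // -num_NSCE //.
exact: (O_NSC (H_ B)).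
Qed.

(** * The verifier *)

Section Verifier.

Variable n : nat.
Notation color := 'I_n.+1.
Notation token := (color * bool)%type.

(* The verifier reads the number of vertices ([Init]) and puts a marker at the
   left end of its work tape, whose cell [v.+1] will stand for the vertex [v].
   Then, for each edge, it reads the color of the edge on the witness in unary
   ([Color c]: [c] ones have been read), walks on the work tape to the source
   ([Walk c false]) and records the token [(c, false)] there, comes back to the
   marker ([Rewind]), and does the same at the target with [(c, true)].  It
   rejects when a token is recorded twice in the same cell.  In the state [Final]
   it checks that the rest of the witness is zero, so that witnesses are unique. *)
Inductive vstate :=
  | Init
  | Color of color
  | Walk of color & bool
  | Rewind of color & bool
  | Final
  | Halt of bool.

Definition vstate_code (q : vstate) : color + token + token + option bool + unit :=
  match q with
  | Init => inr tt
  | Color c => inl (inl (inl (inl c)))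
  | Walk c b => inl (inl (inl (inr (c, b))))
  | Rewind c b => inl (inl (inr (c, b)))
  | Final => inl (inr None)
  | Halt b => inl (inr (Some b))
  end.

Definition vstate_decode (s : color + token + token + option bool + unit) : vstate :=
  match s with
  | inr _ => Init
  | inl (inl (inl (inl c))) => Color c
  | inl (inl (inl (inr (c, b)))) => Walk c b
  | inl (inl (inr (c, b))) => Rewind c b
  | inl (inr None) => Final
  | inl (inr (Some b)) => Halt b
  end.

Lemma vstate_codeK : cancel vstate_code vstate_decode.
Proof. by case. Qed.

HB.instance Definition _ := Finite.copy vstate (can_type vstate_codeK).

(* [None] is the marker; the other symbols are sets of tokens. *)
Definition vaux : finType := option {set token}.
Definition marker : cell vaux := Some (inr None).
Definition is_marker (c : cell vaux) := if c is Some (inr None) then true else false.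
Definition content (c : cell vaux) : {set token} :=
  if c is Some (inr (Some T)) then T else set0.
Definition bit (c : cell vaux) : option bool := if c is Some (inl b) then Some b else None.

(** In order: the next state, whether the input and witness heads advance, and the symbol and move
    for the work tape. *)
Definition vaction := (vstate * bool * bool * (cell vaux * move))%type.

(** In [Color c] the input head stays: it only tests whether another edge follows. There [insub]
    fails on a run of ones exceeding the largest color. *)
Definition vtrans (q : vstate) (x y : option bool) (w : cell vaux) : vaction :=
  let reject := (Halt false, false, false, (w, Stay)) in
  match q with
  | Init => match x with
    | Some true => (Init, true, false, (w, Stay))
    | Some false => (Color ord0, true, false, (marker, MoveRight))
    | None => reject
    end
  | Color c => match x, y with
    | None, _ => (Final, false, false, (w, Stay))
    | Some _, Some true =>
        if insub c.+1 is Some c' then (Color c', false, true, (w, Stay)) else reject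
    | Some _, Some false => (Walk c false, false, true, (w, Stay))
    | Some _, None => reject
    end
  | Walk c b => match x with
    | Some true => (Walk c b, true, false, (w, MoveRight))
    | Some false =>
        if (c, b) \in content w then reject
        else (Rewind c b, true, false, (Some (inr (Some ((c, b) |: content w))), Stay))
    | None => reject
    end
  | Rewind c b =>
      if is_marker w then
        (if b then Color ord0 else Walk c true, false, false, (w, MoveRight))
      else (Rewind c b, false, false, (w, MoveLeft))
  | Final => match y with
    | Some false => (Final, false, true, (w, Stay))
    | Some true => reject
    | None => (Halt true, false, false, (w, Stay))
    end
  | Halt b => (Halt b, false, false, (w, Stay))
  end.

(** One extra tape makes three, with [ord_max] the work tape. The other two keep their symbols and
    are read from left to right. *)
Definition verifier : machine :=
  @Machine vstate vaux 1 Init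
    (fun q => if q is Halt b then Some b else None)
    (fun q r =>
      let: (q', ax, ay, wm) :=
        vtrans q (bit (r (tape0 1))) (bit (r (tape1 1))) (r ord_max) in
      (q', fun i => if i == tape0 1 then (r i, if ax then MoveRight else Stay)
                    else if i == tape1 1 then (r i, if ay then MoveRight else Stay)
                    else wm)).

(* Configurations of the verifier up to blanks: state, unread input, unread
   witness, position on the work tape, and content of the work tape. *)
Definition vconf := (vstate * word * word * nat * (nat -> cell vaux))%type.

Definition update (C : nat -> cell vaux) (j : nat) (w : cell vaux) : nat -> cell vaux :=
  fun i => if i == j then w else C i.

Definition vstep (a : vconf) : vconf :=
  let: (q, xs, ys, j, C) := a in
  let: (q', ax, ay, (w, m)) := vtrans q (ohead xs) (ohead ys) (C j) in
  (q', if ax then behead xs else xs, if ay then behead ys else ys,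
   match m with MoveLeft => j.-1 | Stay => j | MoveRight => j.+1 end, update C j w).

Definition vstate_of (a : vconf) : vstate := a.1.1.1.1.

Definition vhalted (a : vconf) : bool := if vstate_of a is Halt _ then true else false.

(** Cells of the work tape are numbered from the leftmost stored one, which is stable as long as the
    head does not move left from position 0; the default [None] hides trailing blanks. *)
Definition represents (c : config verifier) (a : vconf) : Prop :=
  let: (q, xs, ys, j, C) := a in
  [/\ c.1 = q, word_of_tape (c.2 (tape0 1)) = xs, word_of_tape (c.2 (tape1 1)) = ys,
      size (c.2 ord_max).1 = j &
      forall i, nth None (catrev (c.2 ord_max).1 (c.2 ord_max).2) i = C i].

(* The head of the work tape never moves to the left of the marker. *)
Definition invariant (a : vconf) : Prop :=
  let: (q, _, _, j, C) := a in
  match q with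
  | Init => j = 0
  | Color _ | Walk _ _ => is_marker (C 0) /\ 0 < j
  | Rewind _ _ => is_marker (C 0)
  | Final | Halt _ => True
  end.

(** * Simulation of the tapes *)

Lemma bit_tread (t : tape vaux) : bit (tread t) = ohead (word_of_tape t).
Proof. by case: t => l [|[[[]|]|]]. Qed.

Lemma word_of_tape_stay (t : tape vaux) : word_of_tape (twrite t (tread t)) = word_of_tape t.
Proof. by case: t => l [|[[]|]]. Qed.

Lemma word_of_tape_right (t : tape vaux) : ohead (word_of_tape t) ->
  word_of_tape (tmove (twrite t (tread t)) MoveRight) = behead (word_of_tape t).
Proof. by case: t => l [|[[[]|]|]]. Qed.

Lemma nth_twrite (t : tape vaux) w i :
  nth None (catrev (twrite t w).1 (twrite t w).2) i =
  if i == size t.1 then w else nth None (catrev t.1 t.2) i.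
Proof.
case: t => l r /=; rewrite !catrevE !nth_cat size_rev.
case: ltngtP => [//|lt|->]; last by rewrite subnn.
rewrite -[i - size l]prednK ?subn_gt0 //=.
by case: r => //= ; rewrite nth_nil.
Qed.

Lemma nth_tmove (t : tape vaux) m i : (m = MoveLeft -> 0 < size t.1) ->
  nth None (catrev (tmove t m).1 (tmove t m).2) i = nth None (catrev t.1 t.2) i.
Proof.
case: t m => l r [] //=; first by case: l => [/(_ erefl)|].
case: r => //= _; rewrite !catrevE !nth_cat !size_rev.
by case: ltnP => _ //; case: (i - size l) => [|[]].
Qed.

Lemma size_tmove (t : tape vaux) m :
  size (tmove t m).1 = match m with
    MoveLeft => (size t.1).-1 | Stay => size t.1 | MoveRight => (size t.1).+1 end.
Proof. by case: t m => l r [] //=; rewrite size_behead. Qed.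

(** A reading head advances only over a bit, as [word_of_tape_right] requires. *)
Lemma vtrans_x q x y w : (vtrans q x y w).1.1.2 -> x.
Proof.
case: q x y w => [|c|c b|c b||b] [[]|] [[]|] w //=; do ?case: insub => //.
all: by do ?case: ifP.
Qed.

Lemma vtrans_y q x y w : (vtrans q x y w).1.2 -> y.
Proof.
case: q x y w => [|c|c b|c b||b] [[]|] [[]|] w //=; do ?case: insub => //.
all: by do ?case: ifP.
Qed.

Lemma vtrans_left q x y w : (vtrans q x y w).2.2 = MoveLeft ->
  (if q is Rewind _ _ then true else false) && ~~ is_marker w.
Proof.
case: q x y w => [|c|c b|c b||b] [[]|] [[]|] w //=; do ?case: insub => //.
all: by do ?case: ifP.
Qed.

Lemma update_id (C : nat -> cell vaux) j : update C j (C j) = C.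
Proof. by apply/funext => i; rewrite /update; case: eqP => [->|]. Qed.

Lemma represents_step c a :
  invariant a -> represents c a -> represents (step c) (vstep a).
Proof.
case: a => [[[[q xs] ys] j] C] inv [cq cx cy cj cC].
rewrite /step /halted /= cq.
case: ifP => [|nh]; first by case: q cq {inv} => //= b cq _; rewrite update_id.
rewrite /= !ffunE !bit_tread cx cy.
have Cj : tread (c.2 ord_max) = C j by rewrite -cC catrevE nth_cat size_rev cj ltnn subnn.
rewrite Cj.
have := @vtrans_x q (ohead xs) (ohead ys) (C j).
have := @vtrans_y q (ohead xs) (ohead ys) (C j).
have := @vtrans_left q (ohead xs) (ohead ys) (C j).
case: (vtrans _ _ _ _) => [[[q' ax] ay] [w m]] /= vl vy vx.
(* A left move occurs only in [Rewind] off the marker, and the invariant puts the marker in cell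
   0. *)
have left : m = MoveLeft -> 0 < size (twrite (c.2 ord_max) w).1.
  rewrite /= cj => /vl; case: q {cq nh vl vx vy} inv => // c' b /=.
  by case: (posnP j) => // -> ->.
split=> //=.
- rewrite ffunE; case: ax vx => [/(_ isT) xs1|_]; last by rewrite word_of_tape_stay.
  by rewrite word_of_tape_right cx.
- rewrite ffunE; case: ay vy => [/(_ isT) ys1|_]; last by rewrite word_of_tape_stay.
  by rewrite word_of_tape_right cy.
- by rewrite size_tmove /= cj.
- by move=> i; rewrite nth_tmove // nth_twrite cj cC.
Qed.

Lemma invariant_step a : invariant a -> invariant (vstep a).
Proof.
case: a => [[[[q xs] ys] j] C]; rewrite /vstep.
case: q => [->|c [C0 j0]|c b [C0 j0]|c b C0||b _] /=.
- by case: xs => [|[] xs].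
- case: xs ys => [|x xs] [|[] ys] //=; last by rewrite update_id.
  by case: insub => //= c'; rewrite update_id.
- case: xs => [|[] xs] //=; first by rewrite update_id.
  by case: ifP => //= _; rewrite /update eq_sym eqn0Ngt j0.
- by case: ifP => _ /=; rewrite update_id; case: (b).
- by case: ys => [|[] ys].
- by [].
Qed.

(** * Termination in linear time *)

Definition potential (a : vconf) : nat :=
  let: (q, xs, ys, j, _) := a in
  if q is Halt _ then 0 else
  3 * size xs + size ys + j +
  match q with Rewind _ _ => 4 | Final => 1 | _ => 2 end.

(** The weight 3 of an input letter covers a move to the right, or the extra 2 of [Rewind]; that
    extra 2 in turn covers the move off the marker. *)
Lemma potential_step a : invariant a -> ~~ vhalted a -> potential (vstep a) < potential a.
Proof.
case: a => [[[[q xs] ys] j] C]; rewrite /vstep.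
case: q => [->|c [C0 j0]|c b [C0 j0]|c b C0 _|_ _|b _] //=.
- by case: xs => [|[] xs] /= _; lia.
- case: xs ys => [|x xs] [|[] ys] //= _; try lia.
  by case: insub => [c'|] /=; lia.
- by case: xs => [|[] xs] /= _; try case: ifP => /= _; lia.
- case: ifP => /= mj; first by case: (b); lia.
  by case: (posnP j) mj => [->|]; [rewrite C0 | lia].
- by case: ys => [|[] ys] //=; lia.
Qed.

Lemma vhalted_step a : vhalted a -> vstate_of (vstep a) = vstate_of a.
Proof. by case: a => [[[[[] ?] ?] ?] ?]. Qed.

Lemma halt_stable a t : vhalted a -> vstate_of (iter t vstep a) = vstate_of a.
Proof.
move=> ha; elim: t => //= t IH; rewrite vhalted_step //.
by rewrite /vhalted IH.
Qed.

Lemma invariant_iter a t : invariant a -> invariant (iter t vstep a).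
Proof. by move=> inv; elim: t => //= t; apply: invariant_step. Qed.

Lemma halt_time a t : invariant a -> potential a <= t -> vhalted (iter t vstep a).
Proof.
elim: t a => [|t IH] a inv le_t; case: (boolP (vhalted a)) => ha.
- by [].
- by have := potential_step inv ha; lia.
- by rewrite /vhalted halt_stable.
- rewrite iterSr; apply: IH; first exact: invariant_step.
  by have := potential_step inv ha; lia.
Qed.

(** Leaving the time unbounded allows an analysis step by step; [accepts_time] returns to a fixed
    time. *)
Definition accepts (a : vconf) : bool :=
  `[< exists t, vstate_of (iter t vstep a) = Halt true >].

Lemma accepts_step a : accepts a = accepts (vstep a).
Proof.
apply/asboolP/asboolP=> [[[|t]]|[t at_]]; last by exists t.+1; rewrite iterSr.
  by move=> /= ha; exists 0; rewrite /= vhalted_step // /vhalted ha.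
by rewrite iterSr; exists t.
Qed.

Lemma accepts_halt a b : vstate_of a = Halt b -> accepts a = b.
Proof.
move=> ab; have ha : vhalted a by rewrite /vhalted ab.
apply/asboolP/idP=> [[t]|bt]; last by exists 0; rewrite /= ab bt.
by rewrite halt_stable // ab => -[->].
Qed.

Lemma accepts_time a t : vhalted (iter t vstep a) ->
  accepts a = (vstate_of (iter t vstep a) == Halt true).
Proof.
move=> ht; have -> : accepts a = accepts (iter t vstep a).
  by elim: t {ht} => //= t ->; rewrite -accepts_step.
case E: (vstate_of _) (ht) => [||||| b]; rewrite /vhalted E // => _.
by rewrite (accepts_halt E); case: b {E}; apply/esym/eqP.
Qed.

Definition init (x y : word) : vconf := (Init, x, y, 0, fun=> None).

Lemma represents_run x y t : represents (run verifier x y t) (iter t vstep (init x y)).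
Proof.
elim: t => [|t IH].
  have wt w : word_of_tape (tape_of_word vaux w) = w.
    by rewrite /word_of_tape /=; elim: w => //= b w ->.
  by split; rewrite ?wt //= => i; rewrite nth_nil.
exact: represents_step (invariant_iter _ _) IH.
Qed.

Lemma verifier_halts x y t : 3 * size x + size y + 2 <= t -> halted (run verifier x y t).
Proof.
move=> le_t; have := represents_run x y t.
have : vhalted (iter t vstep (init x y)) by apply: halt_time; rewrite //= addn0.
rewrite /vhalted /halted; case: (iter _ _ _) => [[[[q ?] ?] ?] ?] /=.
by case: q => // b _ [->].
Qed.

Lemma verifier_accepts x y t : 3 * size x + size y + 2 <= t ->
  accepted (run verifier x y t) = accepts (init x y).
Proof.
move=> le_t; have := represents_run x y t.
have ht : vhalted (iter t vstep (init x y)) by apply: halt_time; rewrite //= addn0.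
rewrite (accepts_time ht) /accepted; move: ht.
rewrite /vhalted; case: (iter _ _ _) => [[[[q ?] ?] ?] ?] /=.
by case: q => // b _ [->] /= _ _ _ _; case: b.
Qed.

(** * The witnesses accepted on the code of a graph *)

Definition marked (C : nat -> cell vaux) : Prop :=
  is_marker (C 0) /\ forall v, ~~ is_marker (C v.+1).

Definition add (C : nat -> cell vaux) (p : token * nat) : nat -> cell vaux :=
  update C p.2.+1 (Some (inr (Some (p.1 |: content (C p.2.+1))))).

Lemma marked_add C p : marked C -> marked (add C p).
Proof. by case=> C0 CS; split=> // v; rewrite /add /update; case: eqP. Qed.

Lemma content_add C p v :
  content (add C p v.+1) = if v == p.2 then p.1 |: content (C v.+1) else content (C v.+1).
Proof. by rewrite /add /update eqSS; case: eqP => [->|]. Qed.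

Lemma accepts_walk c b v xs ys j C :
  accepts (Walk c b, unary v ++ xs, ys, j, C) =
  ((c, b) \notin content (C (j + v))) &&
  accepts (Rewind c b, xs, ys, j + v,
           update C (j + v) (Some (inr (Some ((c, b) |: content (C (j + v))))))).
Proof.
elim: v j => [|v IH] j; rewrite accepts_step /=.
  by rewrite addn0; case: ifP => //= _; apply: accepts_halt.
by rewrite update_id IH addSnnS.
Qed.

Lemma accepts_rewind c b xs ys j C : marked C ->
  accepts (Rewind c b, xs, ys, j, C) =
  accepts (if b then Color ord0 else Walk c true, xs, ys, 1, C).
Proof.
case=> C0 CS; elim: j => [|j IH]; rewrite accepts_step /=.
  by rewrite C0 update_id.
by rewrite (negbTE (CS j)) update_id.
Qed.

Lemma accepts_token c b v xs ys C : marked C ->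
  accepts (Walk c b, unary v ++ xs, ys, 1, C) =
  ((c, b) \notin content (C v.+1)) &&
  accepts (if b then Color ord0 else Walk c true, xs, ys, 1, add C (c, b, v)).
Proof.
by move=> mC; rewrite accepts_walk add1n accepts_rewind //; apply: (marked_add (c, b, v)).
Qed.

Lemma accepts_color (c c' : color) m x xs ys j C : c + m = c' ->
  accepts (Color c, x :: xs, unary m ++ ys, j, C) =
  accepts (Walk c' false, x :: xs, ys, j, C).
Proof.
elim: m c => [|m IH] c cm; rewrite accepts_step /=.
  by rewrite update_id; congr (accepts (Walk _ _, _, _, _, _)); apply/ord_inj; rewrite -cm addn0.
have lt_c : c.+1 < n.+1 by have := ltn_ord c'; rewrite -cm; lia.
by rewrite insubT /= update_id; apply: IH; rewrite -cm /= addSnnS.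
Qed.

(** As [c] ones have been read, acceptance forces the rest of a unary color on the witness. *)
Lemma accepts_color_inv (c : color) x xs ys j C :
  accepts (Color c, x :: xs, ys, j, C) ->
  exists (c' : color) ys', c <= c' /\ ys = unary (c' - c) ++ ys'.
Proof.
elim: ys c => [|[] ys IH] c; rewrite accepts_step /=.
- by rewrite (@accepts_halt _ false).
- case: insubP => [c1 _ c1E|_]; last by rewrite (@accepts_halt _ false).
  rewrite update_id => /IH[c' [ys' [le_c ->]]]; rewrite c1E in le_c *.
  exists c', ys'; split; first exact: ltnW.
  by have -> : c' - c = (c' - c.+1).+1 by lia.
- by exists c, ys; rewrite subnn.
Qed.

Lemma accepts_final xs ys j C :
  accepts (Final, xs, ys, j, C) = (ys == nseq (size ys) false).
Proof.
elim: ys => [|[] ys IH]; rewrite accepts_step /=.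
- exact: accepts_halt.
- exact: accepts_halt.
- by rewrite update_id IH eqseq_cons.
Qed.

Fixpoint fresh (C : nat -> cell vaux) (s : seq (token * nat)) : bool :=
  if s is p :: s' then (p.1 \notin content (C p.2.+1)) && fresh (add C p) s' else true.

Lemma freshE C s :
  fresh C s = all (fun p => p.1 \notin content (C p.2.+1)) s && uniq s.
Proof.
elim: s C => //= p s IH C; rewrite IH -andbA; congr andb; rewrite !andbA; congr andb.
rewrite -has_pred1 -all_predC -all_predI; apply: eq_all => -[t v].
case: p => u w; rewrite /= content_add /= xpair_eqE andbC.
by case: eqP; rewrite /= ?andbT ?andbF // in_setU1 negb_or.
Qed.

Definition tokens (cs : seq color) (es : seq (nat * nat)) : seq (token * nat) :=
  flatten [seq [:: (p.1, false, p.2.1); (p.1, true, p.2.2)] | p <- zip cs es].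

Lemma uniq_tokens cs es :
  uniq (tokens cs es) = uniq [seq (p.1, p.2.1) | p <- zip cs es] &&
                        uniq [seq (p.1, p.2.2) | p <- zip cs es].
Proof.
rewrite /tokens; move: (zip cs es) => s.
pose tag (b : bool) (p : color * nat) := ((p.1, b), p.2).
have tag_inj b : injective (tag b) by move=> [c v] [c' v'] [-> ->].
set s1 := [seq (p.1, p.2.1) | p <- s]; set s2 := [seq (p.1, p.2.2) | p <- s].
rewrite -(map_inj_uniq (tag_inj false) s1) -(map_inj_uniq (tag_inj true) s2).
(* The interleaved list is a permutation of the source tokens followed by the target tokens, and the
   boolean tag keeps these two apart. *)
have -> : uniq (flatten [seq [:: (p.1, false, p.2.1); (p.1, true, p.2.2)] | p <- s]) =
    uniq (map (tag false) s1 ++ map (tag true) s2).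
  apply: perm_uniq; rewrite {}/s1 {}/s2; elim: s => //= p s IH.
  rewrite perm_cons perm_sym -cat1s perm_catCA /= perm_cons perm_sym; exact: IH.
rewrite cat_uniq; case: hasP => //= -[_ /mapP[p _ ->] /mapP[p' _ []]] //.
Qed.

Definition edges_word (es : seq (nat * nat)) : word :=
  flatten [seq unary e.1 ++ unary e.2 | e <- es].

Definition colors_word (cs : seq color) : word := flatten [seq unary (c : color) | c <- cs].

Lemma accepts_edge c e xs ys C : marked C ->
  accepts (Walk c false, (unary e.1 ++ unary e.2) ++ xs, ys, 1, C) =
  [&& (c, false) \notin content (C e.1.+1),
      (c, true) \notin content (add C (c, false, e.1) e.2.+1) &
      accepts (Color ord0, xs, ys, 1, add (add C (c, false, e.1)) (c, true, e.2))].
Proof.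
by move=> mC; rewrite -catA accepts_token // accepts_token //; apply: marked_add.
Qed.

Lemma accepts_edges es ys C : marked C ->
  accepts (Color ord0, edges_word es, ys, 1, C) <->
  exists cs m, [/\ size cs = size es, ys = colors_word cs ++ nseq m false &
                   fresh C (tokens cs es)].
Proof.
elim: es ys C => [|e es IH] ys C mC.
  have -> : accepts (Color ord0, edges_word [::], ys, 1, C) = (ys == nseq (size ys) false).
    by rewrite accepts_step /= accepts_final.
  split=> [/eqP ysE|[[|c cs] [m []]] //= _ -> _]; first by exists [::], (size ys).
  by rewrite /= size_nseq.
(* The final zero of a unary number makes the input nonempty, which is how the machine sees that an
   edge remains. *)
have [x [xs xE]] : exists x xs, edges_word (e :: es) = x :: xs.
  by rewrite /edges_word /=; case: e.1 => [|u]; do 2!eexists.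
have mC' c := marked_add (c, true, e.2) (marked_add (c, false, e.1) mC).
split=> [acc|[[|c cs] [m []]] //= [sz] -> fr].
  have := acc; rewrite xE => /accepts_color_inv[c [ys' [_]]]; rewrite subn0 => ysE.
  move: acc; rewrite {}ysE xE (@accepts_color _ c) // -xE.
  rewrite accepts_edge // => /and3P[f1 f2 /(IH _ _ (mC' c))[cs [m [sz -> fr]]]].
  by exists (c :: cs), m; rewrite /= sz catA; split=> //; rewrite f1 f2.
rewrite /colors_word /= -catA xE (@accepts_color _ c) //= -xE accepts_edge //.
by case/and3P: fr => -> -> fr; apply/(IH _ _ (mC' c)); exists cs, m.
Qed.

Lemma accepts_code v es ys :
  accepts (init (edge_list_code v es) ys) <->
  exists cs m, [/\ size cs = size es, ys = colors_word cs ++ nseq m false &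
                   uniq (tokens cs es)].
Proof.
(* After [Init] only the marker is written, so freshness amounts to having no repeated token. *)
pose C := update (fun=> None) 0 marker.
have -> : accepts (init (edge_list_code v es) ys) =
    accepts (Color ord0, edges_word es, ys, 1, C).
  rewrite /init /edge_list_code; elim: v => [|v IH]; rewrite accepts_step //=.
  by rewrite update_id.
have mC : marked C by split=> // i.
have E cs : fresh C (tokens cs es) = uniq (tokens cs es).
  by rewrite freshE (eq_all (a2 := xpredT)) ?all_predT // => p; rewrite /= inE.
by split=> [/(accepts_edges _ _ mC)|] [cs [m [sz yE u]]]; [|apply/(accepts_edges _ _ mC)];
  exists cs, m; rewrite ?E // -E.
Qed.

End Verifier.

(** * Counting the witnesses *)

(** The final zero makes unary words a prefix code. *)
Lemma unary_cat_inj (m m' : nat) (a a' : word) :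
  unary m ++ a = unary m' ++ a' -> m = m' /\ a = a'.
Proof. by elim: m m' => [|m IH] [|m'] //= [] // /IH[-> ->]. Qed.

Lemma colors_word_inj (n : nat) (cs cs' : seq 'I_n.+1) (a a' : word) :
  size cs = size cs' -> colors_word cs ++ a = colors_word cs' ++ a' -> cs = cs'.
Proof.
elim: cs cs' => [|c cs IH] [|c' cs'] //= [sz].
by rewrite /colors_word /= -!catA => /unary_cat_inj[/ord_inj-> /IH->].
Qed.

Lemma size_colors_word (n : nat) (cs : seq 'I_n.+1) :
  size (colors_word cs) <= n.+1 * size cs.
Proof.
elim: cs => [|c cs IH]; first by rewrite muln0.
rewrite /colors_word /= size_cat size_rcons size_nseq mulnS.
exact: leq_add (ltn_ord c) IH.
Qed.

(** Witnesses have a prescribed length; the default [false] supplies the zeros checked in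
    [Final]. *)
Definition pad (L : nat) (w : word) : L.-tuple bool := [tuple nth false w i | i < L].

Lemma val_pad (L : nat) (w : word) : size w <= L ->
  pad L w = w ++ nseq (L - size w) false :> word.
Proof.
move=> le_w; apply: (@eq_from_nth _ false).
  by rewrite size_tuple size_cat size_nseq subnKC.
move=> i; rewrite size_tuple => lt_i.
rewrite -[i]/(val (Ordinal lt_i)) -tnth_nth tnth_mktuple /= nth_cat nth_nseq.
by case: ltnP => // le; rewrite nth_default // if_same.
Qed.

Lemma size_digraph_code (G : digraph) : #|edge G| <= size (digraph_code G).
Proof.
rewrite [#|edge G|]cardE /digraph_code /edge_list_code size_cat.
apply: leq_trans (leq_addl _ _); elim: (enum (edge G)) => //= e s IH.
by rewrite !size_cat !size_rcons addSn ltnS; apply: leq_trans IH (leq_addl _ _).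
Qed.

Section Witnesses.

Variables (n : nat) (G : digraph) (L : nat).
Hypothesis L_large : n.+1 * #|edge G| <= L.
Implicit Type chi : {ffun edge G -> 'I_n.+1}.

Definition witness chi : L.-tuple bool :=
  pad L (colors_word [seq chi e | e <- enum (edge G)]).

Lemma size_witness chi : size (colors_word [seq chi e | e <- enum (edge G)]) <= L.
Proof. by apply: leq_trans (size_colors_word _) _; rewrite size_map -cardE. Qed.

Lemma witness_inj : injective witness.
Proof.
move=> chi chi' /(congr1 val) /=; rewrite !val_pad ?size_witness // => eq_w.
have /eq_in_map eq_chi : [seq chi e | e <- enum (edge G)] = [seq chi' e | e <- enum (edge G)].
  by apply: colors_word_inj eq_w; rewrite !size_map.
by apply/ffunP=> e; rewrite eq_chi ?mem_enum.
Qed.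

Lemma uniq_tokens_proper chi :
  uniq (tokens [seq chi e | e <- enum (edge G)]
     [seq (enum_rank (src e) : nat, enum_rank (tgt e) : nat) | e <- enum (edge G)]) =
  proper_coloring chi.
Proof.
have inj : injective (fun p : 'I_n.+1 * vert G => (p.1, enum_rank p.2 : nat)).
  by move=> [c v] [c' v'] /= [-> /ord_inj/enum_rank_inj->].
rewrite uniq_tokens zip_map /proper_coloring /injectiveb /dinjectiveb.
by move: (enum _) => s; congr andb; rewrite -[RHS](map_inj_uniq inj) -!map_comp.
Qed.

Lemma accepts_digraph_code (y : L.-tuple bool) :
  accepts (init n (digraph_code G) y) <-> exists2 chi, proper_coloring chi & y = witness chi.
Proof.
split=> [/accepts_code[cs [m [sz yE u]]]|[chi chi_p ->]]; last first.
  apply/accepts_code; exists [seq chi e | e <- enum (edge G)]; eexists.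
  by rewrite !size_map uniq_tokens_proper; split=> //; apply: val_pad; apply: size_witness.
rewrite size_map -cardE in sz.
(* The default [ord0] is never reached, since [cs] has one entry per edge. *)
pose chi := [ffun e : edge G => nth ord0 cs (enum_rank e)].
have chiE : [seq chi e | e <- enum (edge G)] = cs.
  apply: (@eq_from_nth _ ord0) => [|i]; rewrite size_map -cardE ?sz // => lt_i.
  have e0 := enum_val (Ordinal lt_i).
  rewrite (nth_map e0) -?cardE // ffunE; congr nth.
  by rewrite -[i]/(val (Ordinal lt_i)) -enum_val_nth enum_valK.
exists chi; first by rewrite -uniq_tokens_proper chiE.
apply: val_inj; rewrite /= val_pad ?size_witness // chiE yE; congr (_ ++ nseq _ _).
by have := congr1 size yE; rewrite size_tuple size_cat size_nseq => ->; rewrite addKn.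
Qed.

Lemma card_accepted :
  #|[set y : L.-tuple bool | accepts (init n (digraph_code G) y)]| =
  #|[set chi : {ffun edge G -> 'I_n.+1} | proper_coloring chi]|.
Proof.
rewrite -(card_imset _ witness_inj); apply: eq_card => y; rewrite inE.
apply/idP/imsetP => [/accepts_digraph_code[chi chi_p ->]|[chi]].
  by exists chi; rewrite ?inE.
by rewrite inE => chi_p ->; apply/accepts_digraph_code; exists chi.
Qed.

End Witnesses.

(** * Membership in #P *)

Lemma in_sharpP_NSC (n : nat) : in_sharpP (NSC_problem n.+1).
Proof.
(* A unary color takes at most [n.+1] letters and the code has at least one letter per edge, whence
   [q]; then [p] is the running time [3 * size x + size y + 2] for witnesses of that length. *)
pose q : {poly nat} := ('X *+ n.+1)%R.
pose p : {poly nat} := ('X *+ (n.+1 + 3) + 2%:P)%R.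
have qE s : q.[s]%R = n.+1 * s.
  by rewrite /q hornerMn hornerX -GRing.mulr_natl natn.
have pE s : p.[s]%R = (n.+1 + 3) * s + 2.
  by rewrite /p hornerD hornerC hornerMn hornerX -GRing.mulr_natl natn.
have le_p x (y : (q.[size x]%R).-tuple bool) :
    3 * size x + size y + 2 <= p.[size x]%R.
  by rewrite size_tuple qE pE; lia.
exists (fun x => #|[set y : (q.[size x]%R).-tuple bool |
                     accepted (run (verifier n) x y p.[size x]%R)]|); split.
  by exists (verifier n), p, q => x; split=> // y; apply: verifier_halts.
move=> G [sc Gk pG]; rewrite /= num_NSCE // -(@card_accepted n G q.[size (digraph_code G)]%R).
  by apply: eq_card => y; rewrite !inE verifier_accepts.
by rewrite qE leq_mul2l size_digraph_code orbT.
Qed.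

Theorem proposition5p9 (k : nat) (hk : 3 <= k) :
  sharpP_hard (Fact_problem k) ->
  sharpP_hard (NSC_problem k) /\ sharpP_complete (NSC_problem k).
Proof.
move=> /sharpP_hard_NSC hard; split=> //; split=> //.
(* Since [k] is positive, it has the form [n.+1] and the verifier has a first color. *)
by case: k hk {hard} => // n _; apply: in_sharpP_NSC.
Qed.
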